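(* Let $E$ be a Henselian valued field and $D$ a tame semiramified division algebra of prime power degree $p^n$ over $E$ ($p$ being a prime integer and $n\ge 1$ an integer). If $char(\bar E)\ne p$ and $p^3$ divides $\exp(Gal(\bar D/\bar E))$, then $D$ has no elementary abelian maximal subfield.
   Context: Division algebras over $E$ are finite-dimensional with center $E$; the degree of $D$ is $\sqrt{[D:E]}$. The valuation of $E$ extends uniquely to $D$; $\bar D,\bar E$ are the residue division ring and residue field, and $\Gamma_D,\Gamma_E$ the value groups. $D$ is semiramified over $E$ if $\bar D$ is a field and $[\bar D:\bar E]=(\Gamma_D:\Gamma_E)=deg(D)$. $D$ is tame if $[D:E]=[\bar D:\bar E](\Gamma_D:\Gamma_E)$, $Z(\bar D)/\bar E$ is separable, and $char(\bar E)$ does not divide the order of the kernel of the homomorphism $\theta_D:\Gamma_D/\Gamma_E\to Gal(Z(\bar D)/\bar E)$ induced by conjugation. For $D$ tame semiramified, $\bar D/\bar E$ is an abelian Galois extension with $Gal(\bar D/\bar E)\cong\Gamma_D/\Gamma_E$. $\exp$ denotes the exponent of a finite group. An elementary abelian maximal subfield is a maximal subfield which is Galois over $E$ with elementary abelian Galois group (here, a group isomorphic to a power of $\mathbb Z/p\mathbb Z$). *)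

(* Defs.v *)
From HB Require Import structures.
From mathcomp Require Import all_boot all_order all_algebra.
From mathcomp Require Import all_fingroup all_solvable all_field.

Set Implicit Arguments.
Unset Strict Implicit.
Unset Printing Implicit Defensive.

Import Order.TTheory GRing.Theory.

Local Open Scope ring_scope.
Local Open Scope quotient_scope.

(* The library has no structure between [porderZmodType], where order and
   addition are unrelated, and ordered rings. *)
HB.mixin Record isOrderedGroup G of Num.POrderedZmodule G := {
  og_total : total (<=%R : rel G);
  lerDr_subproof : forall z x y : G, x <= y -> x + z <= y + z
}.

#[short(type="orderedGroupType")]
HB.structure Definition OrderedGroup :=
  {G of isOrderedGroup G & Num.POrderedZmodule G}.

Section OrderedGroupTheory.
Variable G : orderedGroupType.
Implicit Types x y z : G.

Lemma og_comparable x y : x >=< y.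
Proof. exact: og_total. Qed.

Lemma og_leNgt x y : (x <= y) = ~~ (y < x).
Proof. exact/comparable_leNgt/og_comparable. Qed.

Lemma og_ltNge x y : (x < y) = ~~ (y <= x).
Proof. exact/comparable_ltNge/og_comparable. Qed.

Lemma og_le_min z x y : (z <= Order.min x y) = (z <= x) && (z <= y).
Proof. exact/comparable_le_min/og_comparable. Qed.

Lemma og_lt_min z x y : (z < Order.min x y) = (z < x) && (z < y).
Proof. exact/comparable_lt_min/og_comparable. Qed.

Lemma ogD2r z x y : (x + z <= y + z) = (x <= y).
Proof.
apply/idP/idP; last exact: lerDr_subproof.
by move/(lerDr_subproof (- z)); rewrite !addrK.
Qed.

Lemma ogltD2r z x y : (x + z < y + z) = (x < y).
Proof. by rewrite !og_ltNge ogD2r. Qed.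

Lemma og_addr_ge0 x y : 0 <= x -> 0 <= y -> 0 <= x + y.
Proof. by move=> x0 y0; apply: (le_trans y0); rewrite -{1}[y]add0r ogD2r. Qed.

Lemma og_addr_gt0l x y : 0 < x -> 0 <= y -> 0 < x + y.
Proof. by move=> x0 y0; apply: (le_lt_trans y0); rewrite -{1}[y]add0r ogltD2r. Qed.

Lemma og_addr_gt0r x y : 0 <= x -> 0 < y -> 0 < x + y.
Proof. by move=> x0 y0; rewrite addrC og_addr_gt0l. Qed.

Lemma og_double0 x : x + x = 0 -> x = 0.
Proof.
move=> xx; case: (comparable_ltgtP (og_comparable x 0)) => // [x0|x0].
  by have := x0; rewrite -(ogltD2r x) xx add0r => /(lt_trans x0); rewrite ltxx.
by have := og_addr_gt0l x0 (ltW x0); rewrite xx ltxx.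
Qed.

End OrderedGroupTheory.

(* The value +oo of a valuation at 0 is not represented: the value of the
   function at 0 is arbitrary, and no notion below depends on it.  The function
   need not be surjective; the value group is its image on nonzero elements. *)
Record valuation (G : orderedGroupType) (R : nzRingType) := Valuation {
  val_fun :> R -> G;
  valM : forall x y, x != 0 -> y != 0 -> val_fun (x * y) = val_fun x + val_fun y;
  valD : forall x y, x != 0 -> y != 0 -> x + y != 0 ->
    Order.min (val_fun x) (val_fun y) <= val_fun (x + y)
}.

Definition value_group G (R : nzRingType) (v : valuation G R) (g : G) : Prop :=
  exists2 x : R, x != 0 & v x = g.

Section ResidueRing.
Variables (G : orderedGroupType) (R : nzRingType) (v : valuation G R).

Definition vring_pred : {pred R} := fun x => (x == 0) || (0 <= v x).
Definition videal_pred : {pred R} := fun x => (x == 0) || (0 < v x).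

Lemma val1 : v 1 = 0.
Proof.
have := valM v (oner_neq0 R) (oner_neq0 R).
by rewrite mulr1 -{1}[v 1]addr0 => /addrI.
Qed.

Lemma valN x : v (- x) = v x.
Proof.
have [->|x0] := eqVneq x 0; first by rewrite oppr0.
have N10 : -1 != 0 :> R by rewrite oppr_eq0 oner_neq0.
rewrite -mulN1r valM // (_ : v (-1) = 0) ?add0r //.
by apply: og_double0; rewrite -valM // mulrNN mulr1 val1.
Qed.

Fact vring_subring : subring_closed vring_pred.
Proof.
split=> [|x y|x y]; rewrite !unfold_in.
- by rewrite val1 lexx orbT.
- have [->|x0] := eqVneq x 0; first by rewrite sub0r oppr_eq0 valN.
  have [->|y0] := eqVneq y 0; first by rewrite subr0 (negPf x0).
  have [//|xy0] := eqVneq (x - y) 0 => /= vx vy.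
  have Ny0 : - y != 0 by rewrite oppr_eq0.
  apply: le_trans (valD v x0 Ny0 xy0).
  by rewrite valN og_le_min vx.
- have [->|x0] := eqVneq x 0; first by rewrite mul0r eqxx.
  have [->|y0] := eqVneq y 0; first by rewrite mulr0 eqxx.
  by rewrite valM //= => vx vy; rewrite og_addr_ge0 ?orbT.
Qed.
HB.instance Definition _ := GRing.isSubringClosed.Build R vring_pred vring_subring.

Record vring := VRing { vring_val : R; vringP : vring_val \in vring_pred }.
HB.instance Definition _ := [isSub for vring_val].
HB.instance Definition _ := [Choice of vring by <:].
HB.instance Definition _ := [SubChoice_isSubNzRing of vring by <:].

Definition vmax : {pred vring} := fun x => videal_pred (val x).

Fact vmax_zmod : zmod_closed vmax.
Proof.
split=> [|x y]; rewrite !unfold_in /videal_pred; first by rewrite raddf0 eqxx.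
rewrite raddfB /=; move: (vring_val x) (vring_val y) => {}x {}y.
have [->|x0] := eqVneq x 0; first by rewrite sub0r oppr_eq0 valN.
have [->|y0] := eqVneq y 0; first by rewrite subr0 (negPf x0).
have [//|xy0] := eqVneq (x - y) 0 => /= vx vy.
have Ny0 : - y != 0 by rewrite oppr_eq0.
apply: lt_le_trans (valD v x0 Ny0 xy0).
by rewrite valN og_lt_min vx.
Qed.
HB.instance Definition _ := GRing.isZmodClosed.Build vring vmax vmax_zmod.

Lemma vmaxMl (a x : vring) : x \in vmax -> a * x \in vmax.
Proof.
rewrite !unfold_in /videal_pred rmorphM /=; case: a => a /= aP.
move: (vring_val x) => {}x; move: aP; rewrite unfold_in.
have [->|a0] := eqVneq a 0; first by rewrite mul0r eqxx.
have [->|x0] := eqVneq x 0; first by rewrite mulr0 eqxx.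
by rewrite valM //= => vx vy; rewrite og_addr_gt0r ?orbT.
Qed.

Lemma vmaxMr (a x : vring) : x \in vmax -> x * a \in vmax.
Proof.
rewrite !unfold_in /videal_pred rmorphM /=; case: a => a /= aP.
move: (vring_val x) => {}x; move: aP; rewrite unfold_in.
have [->|a0] := eqVneq a 0; first by rewrite mulr0 eqxx.
have [->|x0] := eqVneq x 0; first by rewrite mul0r eqxx.
by rewrite valM //= => vx vy; rewrite og_addr_gt0l ?orbT.
Qed.

Definition residue := Quotient.quot vmax.
HB.instance Definition _ := GRing.Zmodule.on residue.

Definition residue_pi (x : vring) : residue := \pi_(Quotient.quot vmax) x.
Definition residue_repr (x : residue) : vring := generic_quotient.repr (x : Quotient.quot vmax).

Lemma residue_reprK : cancel residue_repr residue_pi.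
Proof. exact: reprK. Qed.

Lemma residue_piE x y : (residue_pi x == residue_pi y) = (x - y \in vmax).
Proof. by rewrite Quotient.idealrBE. Qed.

Fact residue_pi_zmod : zmod_morphism residue_pi.
Proof. by move=> x y; rewrite /residue_pi !piE. Qed.
HB.instance Definition _ :=
  GRing.isZmodMorphism.Build vring residue residue_pi residue_pi_zmod.

Definition residue_one : residue := residue_pi 1.
Definition residue_mul (x y : residue) : residue :=
  residue_pi (residue_repr x * residue_repr y).

Lemma residue_piM x y :
  residue_pi (x * y) = residue_mul (residue_pi x) (residue_pi y).
Proof.
apply/eqP; rewrite residue_piE.
set x' := residue_repr _; set y' := residue_repr _.
have -> : x * y - x' * y' = x * (y - y') + (x - x') * y'.
  by rewrite mulrBr mulrBl addrA subrK.
apply: rpredD; [apply: vmaxMl | apply: vmaxMr];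
  by rewrite -residue_piE residue_reprK.
Qed.

Fact residue_mulA : associative residue_mul.
Proof.
move=> x y z; rewrite -[x]residue_reprK -[y]residue_reprK -[z]residue_reprK.
by rewrite -!residue_piM mulrA.
Qed.
Fact residue_mul1l : left_id residue_one residue_mul.
Proof. by move=> x; rewrite -[x]residue_reprK -residue_piM mul1r. Qed.
Fact residue_mul1r : right_id residue_one residue_mul.
Proof. by move=> x; rewrite -[x]residue_reprK -residue_piM mulr1. Qed.
Fact residue_mulDl : left_distributive residue_mul +%R.
Proof.
move=> x y z; rewrite -[x]residue_reprK -[y]residue_reprK -[z]residue_reprK.
by rewrite -raddfD -!residue_piM mulrDl raddfD.
Qed.
Fact residue_mulDr : right_distributive residue_mul +%R.
Proof.
move=> x y z; rewrite -[x]residue_reprK -[y]residue_reprK -[z]residue_reprK.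
by rewrite -raddfD -!residue_piM mulrDr raddfD.
Qed.
Fact residue_one_neq0 : residue_one != 0.
Proof.
rewrite -[0]residue_reprK residue_piE.
have : residue_repr 0 \in vmax.
  by rewrite -[residue_repr 0]subr0 -residue_piE residue_reprK raddf0.
move=> m0; apply/negP => m1; have := rpredD m1 m0.
by rewrite subrK unfold_in /videal_pred rmorph1 oner_eq0 val1 ltxx.
Qed.

HB.instance Definition _ := GRing.Zmodule_isNzRing.Build residue
  residue_mulA residue_mul1l residue_mul1r residue_mulDl residue_mulDr
  residue_one_neq0.

Fact residue_pi_monoid : monoid_morphism residue_pi.
Proof. by split=> // x y; rewrite residue_piM. Qed.
HB.instance Definition _ :=
  GRing.isMonoidMorphism.Build vring residue residue_pi residue_pi_monoid.

(* The residue map and a section of it, on the ring itself: [res x] is the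
   residue class of [x] when [x] lies in the valuation ring (and 0 otherwise);
   [lift a] is a representative of [a] in the valuation ring. *)
Definition res (x : R) : residue := residue_pi (insubd 0 x).
Definition lift (a : residue) : R := val (residue_repr a).

Lemma lift_vring a : lift a \in vring_pred.
Proof. exact: valP. Qed.

Lemma liftK : cancel lift res.
Proof. by move=> a; rewrite /res valKd residue_reprK. Qed.

Lemma resE (x : vring) : res (val x) = residue_pi x.
Proof. by rewrite /res valKd. Qed.

Lemma res1 : res 1 = 1.
Proof. by have := resE 1; rewrite !rmorph1. Qed.

Lemma resD x y : x \in vring_pred -> y \in vring_pred ->
  res (x + y) = res x + res y.
Proof.
move=> xO yO; rewrite -[x](insubdK (0 : vring) xO) -[y](insubdK (0 : vring) yO).
by rewrite -rmorphD !resE rmorphD.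
Qed.

Lemma resM x y : x \in vring_pred -> y \in vring_pred ->
  res (x * y) = res x * res y.
Proof.
move=> xO yO; rewrite -[x](insubdK (0 : vring) xO) -[y](insubdK (0 : vring) yO).
by rewrite -rmorphM !resE rmorphM.
Qed.

Lemma res_eq x y : x \in vring_pred -> y \in vring_pred ->
  (res x == res y) = (x - y \in videal_pred).
Proof.
move=> xO yO; rewrite /res residue_piE unfold_in.
by rewrite raddfB /= !insubdK.
Qed.

Lemma res0 : res 0 = 0.
Proof. by have := resE 0; rewrite !raddf0. Qed.

Lemma res_eq0 x : x \in vring_pred -> (res x == 0) = (x \in videal_pred).
Proof.
move=> xO; rewrite -res0 res_eq ?subr0 //.
by rewrite unfold_in eqxx.
Qed.

End ResidueRing.

Section ResidueField.
Variables (G : orderedGroupType) (E : fieldType) (v : valuation G E).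

Definition residue_field := residue v.
HB.instance Definition _ := GRing.NzRing.on residue_field.

Fact residue_field_mulC : commutative (@GRing.mul residue_field).
Proof.
move=> x y; rewrite -[x](@liftK _ _ v) -[y](@liftK _ _ v).
by rewrite -!(@resM _ _ v) ?lift_vring // mulrC.
Qed.
HB.instance Definition _ :=
  GRing.PzRing_hasCommutativeMul.Build residue_field residue_field_mulC.

Definition residue_inv (x : residue_field) : residue_field :=
  if x == 0 then 0 else res v (lift x)^-1.

Fact residue_mulVf : forall x, x != 0 -> residue_inv x * x = 1.
Proof.
move=> x x0; rewrite /residue_inv (negPf x0).
have xO := lift_vring x.
have xm : lift x \notin videal_pred v by rewrite -res_eq0 // liftK.
have lx0 : lift x != 0 by move: xm; rewrite unfold_in negb_or => /andP[].
have vx : v (lift x) = 0.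
  move: xm xO; rewrite !unfold_in (negPf lx0) /= -og_leNgt => le0 ge0.
  by apply/eqP; rewrite eq_le le0 ge0.
have vVx : v (lift x)^-1 = 0.
  by have := valM v (invr_neq0 lx0) lx0; rewrite vx addr0 mulVf ?val1.
rewrite -[X in _ * X](@liftK _ _ v) -(@resM _ _ v) ?mulVf ?res1 //.
by rewrite unfold_in vVx lexx orbT.
Qed.

Fact residue_inv0 : residue_inv 0 = 0.
Proof. by rewrite /residue_inv eqxx. Qed.

HB.instance Definition _ :=
  GRing.ComNzRing_isField.Build residue_field residue_mulVf residue_inv0.

(* Hensel's lemma: a simple root of the reduction of f lifts to a root of f. *)
Definition henselian : Prop :=
  forall (f : {poly E}) (a : E),
    f \is a polyOver (vring_pred v) -> a \in vring_pred v ->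
    f.[a] \in videal_pred v -> f^`().[a] \notin videal_pred v ->
  exists b : E, [/\ b \in vring_pred v, root f b & b - a \in videal_pred v].

End ResidueField.

Record extension (G : orderedGroupType) (E : fieldType) (v : valuation G E)
    (D : falgType E) := Extension {
  ext_val :> valuation G D;
  extP : forall c : E, c != 0 -> ext_val c%:A = v c
}.

Section ResidueAlgebra.
Variables (G : orderedGroupType) (E : fieldType) (v : valuation G E).
Variables (D : falgType E) (w : extension v D).

Definition residue_algebra := residue w.
HB.instance Definition _ := GRing.NzRing.on residue_algebra.

Lemma alg_vring c : c \in vring_pred v -> c%:A \in vring_pred w.
Proof.
rewrite !unfold_in; have [->|c0] := eqVneq c 0; first by rewrite scale0r eqxx.
by rewrite extP //= => ->; rewrite orbT.
Qed.

Lemma alg_videal c : c \in videal_pred v -> c%:A \in videal_pred w.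
Proof.
rewrite !unfold_in; have [->|c0] := eqVneq c 0; first by rewrite scale0r eqxx.
by rewrite extP //= => ->; rewrite orbT.
Qed.

Definition residue_alg (a : residue_field v) : residue_algebra :=
  res w (lift a)%:A.

Lemma residue_algE c : c \in vring_pred v -> residue_alg (res v c) = res w c%:A.
Proof.
move=> cO; apply/eqP; rewrite /residue_alg.
have lO := lift_vring (res v c).
rewrite res_eq ?alg_vring // -scalerBl alg_videal //.
by rewrite -(@res_eq _ _ v) // liftK.
Qed.

Definition residue_scale (a : residue_field v) (x : residue_algebra) :
  residue_algebra := residue_alg a * x.

Lemma residue_algM a b : residue_alg (a * b) = residue_alg a * residue_alg b.
Proof.
have aO := lift_vring a; have bO := lift_vring b.
rewrite -{1}[a](@liftK _ _ v) -{1}[b](@liftK _ _ v) -(@resM _ _ v) //.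
rewrite residue_algE ?rpredM // /residue_alg.
by rewrite -[RHS](@resM _ _ w) ?alg_vring // -scalerAl mul1r scalerA.
Qed.

Lemma residue_algD a b : residue_alg (a + b) = residue_alg a + residue_alg b.
Proof.
have aO := lift_vring a; have bO := lift_vring b.
rewrite -{1}[a](@liftK _ _ v) -{1}[b](@liftK _ _ v) -(@resD _ _ v) //.
rewrite residue_algE ?rpredD // /residue_alg.
by rewrite -[RHS](@resD _ _ w) ?alg_vring // -scalerDl.
Qed.

Lemma residue_alg1 : residue_alg 1 = 1.
Proof.
rewrite -(@res1 _ _ v) residue_algE; first by rewrite scale1r res1.
exact: rpred1.
Qed.

Lemma residue_algC a x : residue_alg a * x = x * residue_alg a.
Proof.
rewrite -[x](@liftK _ _ w) /residue_alg.
rewrite -[LHS](@resM _ _ w) -1?[RHS](@resM _ _ w) ?alg_vring ?lift_vring //.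
by rewrite -scalerAl -scalerAr mul1r mulr1.
Qed.

Fact residue_scaleA a b x :
  residue_scale a (residue_scale b x) = residue_scale (a * b) x.
Proof. by rewrite /residue_scale residue_algM mulrA. Qed.
Fact residue_scale1 : left_id 1 residue_scale.
Proof. by move=> x; rewrite /residue_scale residue_alg1 mul1r. Qed.
Fact residue_scaleDr : right_distributive residue_scale +%R.
Proof. by move=> a x y; rewrite /residue_scale mulrDr. Qed.
Fact residue_scaleDl x : {morph residue_scale^~ x : a b / a + b}.
Proof. by move=> a b; rewrite /residue_scale residue_algD mulrDl. Qed.
HB.instance Definition _ := GRing.Zmodule_isLmodule.Build (residue_field v)
  residue_algebra residue_scaleA residue_scale1 residue_scaleDr residue_scaleDl.

Fact residue_scaleAl (a : residue_field v) (x y : residue_algebra) :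
  a *: (x * y) = a *: x * y.
Proof. by rewrite /GRing.scale /= /residue_scale mulrA. Qed.
HB.instance Definition _ := GRing.Lmodule_isLalgebra.Build (residue_field v)
  residue_algebra residue_scaleAl.

Fact residue_scaleAr (a : residue_field v) (x y : residue_algebra) :
  a *: (x * y) = x * (a *: y).
Proof. by rewrite /GRing.scale /= /residue_scale !mulrA residue_algC. Qed.
HB.instance Definition _ := GRing.Lalgebra_isAlgebra.Build (residue_field v)
  residue_algebra residue_scaleAr.

End ResidueAlgebra.

Definition has_dim (K : fieldType) (V : lmodType K) (d : nat) : Prop :=
  inhabited (Vector.axiom d V).

(* For subgroups [B] of [A]: [f] is a transversal of [A / B]. *)
Definition has_index (G : zmodType) (A B : G -> Prop) (m : nat) : Prop :=
  exists f : 'I_m -> G,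
    (forall i, A (f i)) /\ (forall g, A g -> exists! i, B (g - f i)).

Definition is_field (R : nzRingType) : Prop :=
  commutative (@GRing.mul R) /\ forall x : R, x != 0 -> exists y, y * x = 1.

Definition central (R : nzRingType) (z : R) : Prop := forall x, z * x = x * z.

Definition separable_over (K : fieldType) (A : algType K) (z : A) : Prop :=
  exists q : {poly K}, [/\ q \is monic, irreducible_poly q,
    horner_alg z q = 0 & separable_poly q].

(* [rho] identifies [Gal] with the (finite) group of all K-algebra automorphisms
   of A, which is Gal(A / K) when A is a finite Galois extension of K. *)
Definition is_galois_group (K : fieldType) (A : algType K)
    (Gal : finGroupType) (rho : Gal -> {lrmorphism A -> A}) : Prop :=
  [/\ forall s, bijective (rho s),
      forall s t, rho (s * t)%g =1 rho s \o rho t,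
      forall s t, rho s =1 rho t -> s = t
    & forall u : {lrmorphism A -> A}, bijective u -> exists s, rho s =1 u].

Section DivisionAlgebra.
Variables (E : fieldType) (D : falgType E).

Definition central_division_algebra : Prop :=
  (forall x : D, x != 0 -> x \is a GRing.unit) /\
  ('Z({:D}) = 1)%VS.

Definition has_degree (d : nat) : Prop := \dim {:D} = (d ^ 2)%N.

Definition is_subfield (K : {vspace D}) : Prop :=
  [/\ 1 \in K, {in K &, forall x y, x * y \in K},
      {in K, forall x, x^-1 \in K} & {in K &, commutative *%R}].

(* Subfields of D are taken to contain its center E, which loses nothing for
   maximal ones. *)
Definition maximal_subfield (M : {vspace D}) : Prop :=
  is_subfield M /\ forall K, is_subfield K -> (M <= K)%VS -> K = M.

(* The subfield M is presented as the image of an extension L of E. *)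
Definition elementary_abelian_maximal_subfield (p : nat) (M : {vspace D}) :=
  maximal_subfield M /\
  exists (L : splittingFieldType E) (f : 'AHom(L, D)),
    [/\ limg f = M, galois 1 {:L} & (p.-abelem 'Gal({:L} / 1))%g].

End DivisionAlgebra.

Section ValuedDivisionAlgebra.
Variables (G : orderedGroupType) (E : fieldType) (v : valuation G E).
Variables (D : falgType E) (w : extension v D).

Notation Ebar := (residue_field v).
Notation Dbar := (residue_algebra w).

Definition has_ramification_index (e : nat) : Prop :=
  has_index (value_group w) (value_group v) e.

(* Conjugation by [d] on the residue ring; it depends only on [w d] modulo the
   value group of E on the center of the residue ring. *)
Definition theta (d : D) (x : Dbar) : Dbar := res w (d * lift x * d^-1).

(* The preimage in the value group of D of the kernel of theta_D. *)
Definition theta_kernel (g : G) : Prop :=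
  exists d : D, [/\ d != 0, w d = g & forall z : Dbar, central z -> theta d z = z].

Definition semiramified : Prop :=
  is_field Dbar /\
  exists d, [/\ has_degree D d, has_dim Dbar d & has_ramification_index d].

Definition tame : Prop :=
  [/\ exists f e, [/\ has_dim Dbar f, has_ramification_index e
                    & \dim {:D} = (f * e)%N],
      forall z : Dbar, central z -> separable_over z
    & exists k, has_index theta_kernel (value_group v) k /\
        forall q, q \in [pchar Ebar] -> ~~ (q %| k)%N].

End ValuedDivisionAlgebra.

(* Main.v *)
Require Import Defs.
From Stdlib Require Import Classical.
From HB Require Import structures.
From mathcomp Require Import all_boot all_order all_algebra.
From mathcomp Require Import all_fingroup all_solvable all_field.

Set Implicit Arguments.
Unset Strict Implicit.
Unset Printing Implicit Defensive.

Import Order.TTheory GRing.Theory.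
Local Open Scope ring_scope.

(** The theorem holds because the exponent of Gal(K / k) divides p ^ 2, where k
    and K are the residue algebras of E and D, as soon as D has an elementary
    abelian maximal subfield M, the image of f : L -> D.

    Conjugation by a nonzero x of D induces an automorphism theta x of K.  Call
    x a twist when conjugation by x maps M to itself, acting there as an element
    of Gal(L / E).  The main point is that every automorphism h of K over k is
    theta x for some twist x ([automorphism_conjugation]).  Granted that, x ^+ p
    centralises M, because Gal(L / E) has exponent p, so x ^+ p lies in M; and
    the p-th power of an element of M has the value of an element of E
    ([exp_p_value]), so x ^+ (p ^ 2) is a scalar times a unit, and induces the
    identity on the commutative ring K.

    By Artin's theorem ([artin]), the main point follows if k is the field fixed
    by the theta x, for x a twist.  Let the residue of d be fixed by them.  Being
    fixed by theta x for x in M already makes it the residue of an element of M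
    ([fixed_residue_in_subfield]): as an M-bimodule, D is the direct sum of the
    D_g, g in Gal(L / E), where d * f y = f (g y) * d on D_g, and D_1 = M is the
    centraliser of M; the component of d in some other D_g is killed by
    d |-> (f (g b) * d - d * f b) / f (g b - b), which is the identity on D_1 and
    does not change the residue of d when b and g b - b have the same value, since
    theta (f b) fixes this residue.  Such a b exists because the residue
    characteristic is not p ([tame_displacement]).  Finally every g in
    Gal(L / E) is induced by a twist ([skolem_noether]), so that averaging over
    Gal(L / E) an element of M with the given residue yields an element of E with
    this residue ([fixed_residue_in_base]).  The existence of these twists also shows that
    Gal(L / E) preserves the valuation.

    The values of p-th powers are computed by replacing an element of L by one
    of the same value and with a stabiliser as large as possible in Gal(L / E).
    The lines of a rank 2 elementary abelian group cover it, which forces this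
    stabiliser to have index at most p ([stabiliser_index]), and a norm of p
    factors then lands in E. *)

(** * Artin's theorem for an algebra that is a field *)

Section FieldStructure.
Variables (K : nzRingType) (fieldK : is_field K).

Fact is_field_inv_ex (x : K) : exists y : K, (x != 0) ==> (y * x == 1).
Proof.
have [->|x0] := eqVneq x 0; first by exists 0.
by have [_ /(_ x x0)[y yx]] := fieldK; exists y; rewrite yx eqxx.
Qed.

Definition is_field_inv (x : K) : K :=
  if x == 0 then 0 else xchoose (is_field_inv_ex x).

Fact is_field_mulVf (x : K) : x != 0 -> is_field_inv x * x = 1.
Proof.
move=> x0; rewrite /is_field_inv; case: ifPn => [x00|_]; first by rewrite x00 in x0.
by have /implyP/(_ x0)/eqP := xchooseP (is_field_inv_ex x).
Qed.

Fact is_field_inv0 : is_field_inv 0 = 0.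
Proof. by rewrite /is_field_inv; case: ifPn => // /eqP[]. Qed.

(** Both structures live on the carrier of K and extend its ring structure, so
    elements, polynomials and morphisms of K can be read in them. *)
Definition is_field_comNzRing : comNzRingType :=
  HB.pack (K : Type) K (GRing.PzRing_hasCommutativeMul.Build K (proj1 fieldK)).

Definition is_field_field : fieldType :=
  HB.pack (K : Type) is_field_comNzRing
    (GRing.ComNzRing_isField.Build is_field_comNzRing is_field_mulVf is_field_inv0).

End FieldStructure.

Section PrimitiveElement.
Variables (k : fieldType) (K : algType k) (d : nat).
Hypotheses (fieldK : is_field K) (dimK : has_dim K d).
Hypothesis sepK : forall z : K, separable_over z.

(** An automorphism of K over k is then determined by its value at a. *)
Lemma primitive_element : exists a : K, forall x, exists r : {poly k},
  x = horner_alg a r.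
Proof.
case: dimK => axK.
pose F : fieldExtType k :=
  HB.pack (K : Type) K (is_field_field fieldK) (Lmodule_hasFinDim.Build k K axK).
have sepF : separable 1%AS (fullv : {vspace F}).
  apply/separableP => z _; have [q [qm qi qz qs]] := sepK z.
  apply/separable_elementP; exists (map_poly (in_alg F) q); split.
  - by apply/polyOver1P; exists q.
  - by apply/eqP; rewrite -[RHS]qz.
  - by rewrite separable_map.
have gen := eq_adjoin_separable_generator sepF (sub1v _).
exists (separable_generator 1%AS (fullv : {vspace F})).
move=> x; have : (x : F) \in <<1%AS; separable_generator 1%AS fullv>>%VS.
  by rewrite -gen memvf.
by case/Fadjoin_polyP => q /polyOver1P[r ->] ->; exists r.
Qed.

Lemma lrmorph_horner_alg (s : {lrmorphism K -> K}) (a : K) (r : {poly k}) :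
  s (horner_alg a r) = horner_alg (s a) r.
Proof.
rewrite /horner_alg /horner_morph -horner_map /= -map_poly_comp.
by congr _.[_]; apply: eq_map_poly => c; rewrite /= rmorph_alg.
Qed.

(** With K = k[a], the polynomial whose roots are the s a, s in S, is invariant
    under S, hence has coefficients in k.  So h maps its root a to another root,
    and h agrees with some s in S at a, hence everywhere. *)
Lemma artin (Gal : finGroupType) (rho : Gal -> {lrmorphism K -> K})
    (S : {set Gal}) :
  is_galois_group rho -> 1%g \in S -> {in S &, forall s t, (s * t)%g \in S} ->
  (forall z : K, (forall s, s \in S -> rho s z = z) -> exists c : k, z = c%:A) ->
  forall h, h \in S.
Proof.
move=> [bij_rho rhoM rho_inj _] S1 SM fixS h.
have [a gen_a] := primitive_element.
have agree s t : rho s a = rho t a -> s = t.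
  move=> st; apply: rho_inj => x; have [r ->] := gen_a x.
  by rewrite !lrmorph_horner_alg st.
have rho1 : rho 1%g a = a.
  have [g gK _] := bij_rho 1%g; apply: (can_inj gK).
  by have := rhoM 1%g 1%g a; rewrite mulg1 => /= <-.
pose F := is_field_field fieldK.
pose sig s : {rmorphism F -> F} := rho s.
pose P : {poly F} := \prod_(s in S) ('X - (rho s a : F)%:P).
have fixP s : s \in S -> map_poly (sig s) P = P.
  move=> sS; rewrite rmorph_prod /=.
  have mul_inj : {in S &, injective (fun t => (s * t)%g)} by move=> ? ? _ _ /mulgI.
  have imS : [set (s * t)%g | t in S] = S.
    apply/eqP; rewrite eqEcard card_in_imset // leqnn andbT.
    by apply/subsetP => _ /imsetP[t tS ->]; apply: SM.
  rewrite /P -{2}imS big_imset //; apply: eq_bigr => t tS.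
  rewrite rmorphB /= map_polyX map_polyC /=; congr ('X - _%:P).
  by rewrite [RHS]rhoM.
have coefP i : exists c : k, P`_i == c%:A :> K.
  have [|c ->] := fixS P`_i; last by exists c.
  by move=> s sS; rewrite -{2}(fixP s sS) coef_map.
pose r : {poly k} := \poly_(i < size P) xchoose (coefP i).
have rE : map_poly (in_alg K) r = P :> {poly K}.
  apply/polyP => i; rewrite coef_map coef_poly; case: ltnP => [lt_i|le_i] /=.
    by rewrite -(eqP (xchooseP (coefP i))).
  by rewrite scale0r [RHS]nth_default.
have rootP (x : F) : P.[x] = horner_alg (x : K) r.
  by rewrite /horner_alg /horner_morph rE.
have Pa : P.[(a : F)] = 0.
  apply/eqP; rewrite horner_prod; apply/prodf_eq0; exists 1%g => //.
  by rewrite hornerXsubC subr_eq0 rho1.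
have : P.[(rho h a : F)] == 0.
  rewrite rootP -lrmorph_horner_alg -rootP Pa.
  by rewrite raddf0.
rewrite horner_prod => /prodf_eq0[s sS].
by rewrite hornerXsubC subr_eq0 => /eqP/agree ->.
Qed.

End PrimitiveElement.

(** * Valued division rings *)

Section ValuedDivisionRing.
Variables (G : orderedGroupType) (D : unitRingType) (w : valuation G D).
Hypothesis divD : forall x : D, x != 0 -> x \is a GRing.unit.
Implicit Types x y d : D.

Lemma div_mulf_neq0 x y : x != 0 -> y != 0 -> x * y != 0.
Proof.
move=> x0 y0; apply: contraNneq y0 => xy0.
by rewrite -(mulKr (divD x0) y) xy0 mulr0.
Qed.

Lemma val_inv x : x != 0 -> w x^-1 = - w x.
Proof.
move=> x0; have xV0 : x^-1 != 0 by rewrite invr_eq0.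
apply/eqP; rewrite -addr_eq0 -(Defs.valM w xV0 x0) mulVr ?divD //.
by rewrite (Defs.val1 w).
Qed.

Lemma val_conj d x : d != 0 -> x != 0 -> w (d * x * d^-1) = w x.
Proof.
move=> d0 x0; have dV0 : d^-1 != 0 by rewrite invr_eq0.
rewrite !Defs.valM ?div_mulf_neq0 // val_inv //.
by rewrite addrAC subrr add0r.
Qed.

Lemma conj_eq0 d x : d != 0 -> (d * x * d^-1 == 0) = (x == 0).
Proof.
move=> d0; apply/eqP/eqP => [|->]; last by rewrite mulr0 mul0r.
move/(congr1 (fun z => d^-1 * (z * d))).
by rewrite mulrVK ?divD // mulKr ?divD // mul0r mulr0.
Qed.

Lemma vring_conj d x : d != 0 ->
  (d * x * d^-1 \in vring_pred w) = (x \in vring_pred w).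
Proof.
move=> d0; rewrite !unfold_in conj_eq0 //.
by have [//|x0] := eqVneq x 0; rewrite val_conj.
Qed.

Lemma videal_conj d x : d != 0 ->
  (d * x * d^-1 \in videal_pred w) = (x \in videal_pred w).
Proof.
move=> d0; rewrite !unfold_in conj_eq0 //.
by have [//|x0] := eqVneq x 0; rewrite val_conj.
Qed.

Lemma res_conj d x y : d != 0 -> x \in vring_pred w -> y \in vring_pred w ->
  res w x = res w y -> res w (d * x * d^-1) = res w (d * y * d^-1).
Proof.
move=> d0 xO yO /eqP; rewrite res_eq // => xy.
by apply/eqP; rewrite res_eq ?vring_conj // -mulrBl -mulrBr videal_conj.
Qed.

Lemma vring_res_neq0 x : x \in vring_pred w -> res w x != 0 ->
  x != 0 /\ w x = 0.
Proof.
move=> xO; rewrite res_eq0 // !unfold_in negb_or -og_leNgt => /andP[x0 le0].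
split=> //; move: xO; rewrite unfold_in (negPf x0) /= => ge0.
by apply/eqP; rewrite eq_le le0.
Qed.

Lemma res_neq0 x : x != 0 -> w x = 0 -> x \in vring_pred w /\ res w x != 0.
Proof.
move=> x0 wx; have xO : x \in vring_pred w by rewrite unfold_in wx lexx orbT.
by split=> //; rewrite res_eq0 // unfold_in (negPf x0) wx ltxx.
Qed.

Lemma res_inv x : x \in vring_pred w -> res w x != 0 ->
  x^-1 \in vring_pred w /\ res w x * res w x^-1 = 1.
Proof.
move=> xO rx; have [x0 wx] := vring_res_neq0 xO rx.
have xVO : x^-1 \in vring_pred w.
  by rewrite unfold_in val_inv // wx oppr0 lexx orbT.
by split=> //; rewrite -resM // mulrV ?divD // res1.
Qed.

Lemma res_div_neq0 x y : x != 0 -> y != 0 -> w x = w y ->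
  x / y \in vring_pred w /\ res w (x / y) != 0.
Proof.
move=> x0 y0 xy; have yV0 : y^-1 != 0 by rewrite invr_eq0.
apply: res_neq0; first exact: div_mulf_neq0.
by rewrite Defs.valM // val_inv // xy subrr.
Qed.

(** Together with [res_div_neq0], this expresses equality of values through the
    residue of a quotient, which is additive in the numerator. *)
Lemma val_div_res x y : y != 0 -> x / y \in vring_pred w ->
  res w (x / y) != 0 -> x != 0 /\ w x = w y.
Proof.
move=> y0 xyO /(vring_res_neq0 xyO)[xy0 wxy].
have x0 : x != 0 by apply: contraNneq xy0 => ->; rewrite mul0r.
have yV0 : y^-1 != 0 by rewrite invr_eq0.
split=> //; apply/eqP; rewrite -subr_eq0 -val_inv // -Defs.valM //.
by rewrite wxy.
Qed.

End ValuedDivisionRing.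

Section ResidueSums.
Variables (G : orderedGroupType) (R : nzRingType) (v : valuation G R).

Lemma res_sum (I : Type) (r : seq I) (P : pred I) (F : I -> R) :
  (forall i, P i -> F i \in vring_pred v) ->
  res v (\sum_(i <- r | P i) F i) = \sum_(i <- r | P i) res v (F i).
Proof.
move=> FO; have [//] : \sum_(i <- r | P i) F i \in vring_pred v /\
  res v (\sum_(i <- r | P i) F i) = \sum_(i <- r | P i) res v (F i).
apply: (big_rec2 (fun x y => x \in vring_pred v /\ res v x = y)).
  by rewrite rpred0 res0.
by move=> i x _ Pi [xO <-]; have FiO := FO i Pi; split; [exact: rpredD | exact: resD].
Qed.

Lemma res_nat n : res v n%:R = n%:R.
Proof.
elim: n => [|n IHn]; first exact: res0.
by rewrite -addn1 !natrD resD ?rpred_nat // IHn res1.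
Qed.

Lemma val_exp x n : x != 0 -> (forall n, x ^+ n != 0) -> v (x ^+ n) = v x *+ n.
Proof.
move=> x0 xn0; elim: n => [|n IHn]; first exact: Defs.val1.
by rewrite exprS Defs.valM // IHn mulrS.
Qed.

End ResidueSums.

Section Pullback.
Variables (G : orderedGroupType) (F : fieldType) (R : nzRingType).
Variables (f : {rmorphism F -> R}) (w : valuation G R).

Fact pullback_valM (x y : F) : x != 0 -> y != 0 ->
  w (f (x * y)) = w (f x) + w (f y).
Proof. by move=> x0 y0; rewrite rmorphM Defs.valM ?fmorph_eq0. Qed.

Fact pullback_valD (x y : F) : x != 0 -> y != 0 -> x + y != 0 ->
  Order.min (w (f x)) (w (f y)) <= w (f (x + y)).
Proof.
by move=> x0 y0 xy0; rewrite rmorphD; apply: Defs.valD; rewrite -?rmorphD fmorph_eq0.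
Qed.

Definition pullback : valuation G F := Valuation pullback_valM pullback_valD.

Lemma pullback_vring x : (x \in vring_pred pullback) = (f x \in vring_pred w).
Proof. by rewrite !unfold_in fmorph_eq0. Qed.

Lemma pullback_videal x : (x \in videal_pred pullback) = (f x \in videal_pred w).
Proof. by rewrite !unfold_in fmorph_eq0. Qed.

(** The residue rings of the two valuations are different types; this is how
    information about units passes between them. *)
Lemma pullback_res_eq0 x : x \in vring_pred pullback ->
  (res pullback x == 0) = (res w (f x) == 0).
Proof.
by move=> xO; rewrite !res_eq0 ?pullback_videal // -pullback_vring.
Qed.

End Pullback.

Section Theta.
Variables (G : orderedGroupType) (E : fieldType) (v : valuation G E).
Variables (D : falgType E) (w : extension v D).
Hypothesis divD : forall x : D, x != 0 -> x \is a GRing.unit.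
Notation K := (residue_algebra w).

(** The class of x * d * x^-1 does not depend on the representative d. *)
Lemma theta_res x d : x != 0 -> d \in vring_pred w ->
  theta x (res w d) = res w (x * d * x^-1) :> K.
Proof.
move=> x0 dO; apply: res_conj => //; first exact: lift_vring.
by rewrite Defs.liftK.
Qed.

Lemma theta1 (z : K) : theta 1 z = z.
Proof. by rewrite /theta mul1r invr1 mulr1 Defs.liftK. Qed.

Lemma thetaM x y (z : K) : x != 0 -> y != 0 -> theta (x * y) z = theta x (theta y z).
Proof.
move=> x0 y0; rewrite -[z](@Defs.liftK _ _ w) !theta_res ?vring_conj ?lift_vring //.
  by rewrite invrM ?divD // !mulrA.
exact: div_mulf_neq0.
Qed.

Lemma theta_automorphism x : x != 0 ->
  exists2 s : {lrmorphism K -> K}, s =1 theta x & bijective s.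
Proof.
move=> x0; have xV0 : x^-1 != 0 by rewrite invr_eq0.
have thB : zmod_morphism (theta x : K -> K).
  move=> a b; rewrite -[a](@Defs.liftK _ _ w) -[b](@Defs.liftK _ _ w).
  have aO := lift_vring a; have bO := lift_vring b.
  have NbO : - Defs.lift b \in vring_pred w by rewrite rpredN.
  have resB (c e : D) : c \in vring_pred w -> e \in vring_pred w ->
      res w (c - e) = res w c - res w e.
    move=> cO eO; apply: (addIr (res w e)); rewrite subrK -resD ?subrK //.
    by rewrite rpredB.
  by rewrite -resB // !theta_res ?rpredB // mulrBr mulrBl resB ?vring_conj.
have thM : monoid_morphism (theta x : K -> K).
  split; first by rewrite -(res1 w) theta_res ?rpred1 // mulr1 mulrV ?divD.
  move=> a b; rewrite -[a](@Defs.liftK _ _ w) -[b](@Defs.liftK _ _ w).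
  have aO := lift_vring a; have bO := lift_vring b.
  rewrite -[res w _ * _]resM // !theta_res ?rpredM //.
  rewrite -[RHS]resM ?vring_conj //; congr (res w _).
  by rewrite -!mulrA mulKr ?divD.
have thA c : theta x (residue_alg w c) = residue_alg w c.
  rewrite /residue_alg theta_res ?alg_vring ?lift_vring //.
  by rewrite mulr_algr -scalerAl mulrV ?divD.
have thZ : scalable (theta x : K -> K).
  move=> c a; rewrite /GRing.scale /= /residue_scale.
  by rewrite thM.2 thA.
pose s : {lrmorphism K -> K} := HB.pack (theta x : K -> K)
  (GRing.isZmodMorphism.Build K K _ thB) (GRing.isMonoidMorphism.Build K K _ thM)
  (GRing.isScalable.Build _ K K _ _ thZ).
exists s => //; exists (theta x^-1) => z /=; rewrite -thetaM //.
  by rewrite mulVr ?divD // theta1.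
by rewrite mulrV ?divD // theta1.
Qed.

End Theta.

(** * Elementary abelian groups of isometries of a valued field *)

Lemma big_cyclic_shift (T : Type) (idx : T) (op : Monoid.com_law idx) n
    (F : nat -> T) : F n = F 0 ->
  \big[op/idx]_(i < n) F i.+1 = \big[op/idx]_(i < n) F i.
Proof.
case: n => [|n] Fn; first by rewrite !big_ord0.
by rewrite big_ord_recr /= Fn Monoid.mulmC [RHS]big_ord_recl.
Qed.

Section Isometries.
Variables (G : orderedGroupType) (F : fieldType) (v : valuation G F).
Variables (gT : finGroupType) (A : {group gT}) (p : nat).
Variable act : gT -> {rmorphism F -> F}.
Hypotheses (pr_p : prime p) (pA : (p.-abelem A)%g).
Hypothesis act1 : act 1%g =1 id.
Hypothesis actM : {in A &, forall g h, act (g * h)%g =1 act g \o act h}.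
Hypothesis act_isom : forall g y, y != 0 -> v (act g y) = v y.
Hypothesis p_res : p%:R != 0 :> residue v.

Let ufield (x : F) : x != 0 -> x \is a GRing.unit.
Proof. by rewrite unitfE. Qed.

Lemma act_vring g y : (act g y \in vring_pred v) = (y \in vring_pred v).
Proof.
by rewrite !unfold_in fmorph_eq0; have [//|y0] := eqVneq y 0; rewrite act_isom.
Qed.

Lemma act_res g x y : x \in vring_pred v -> y \in vring_pred v ->
  res v x = res v y -> res v (act g x) = res v (act g y).
Proof.
move=> xO yO /eqP; rewrite res_eq // => xy; apply/eqP.
rewrite res_eq ?act_vring // -rmorphB; move: xy; rewrite !unfold_in fmorph_eq0.
by have [//|xy0] := eqVneq (x - y) 0; rewrite act_isom.
Qed.

Lemma act_div g x m : m != 0 -> x / m \in vring_pred v ->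
  act g x / m \in vring_pred v /\
  (res v (x / m) = 0 -> res v (act g x / m) = 0).
Proof.
move=> m0 xmO; have gm0 : act g m != 0 by rewrite fmorph_eq0.
have [gmO _] := res_div_neq0 ufield gm0 m0 (act_isom g m0).
have -> : act g x / m = act g (x / m) * (act g m / m).
  by rewrite fmorph_div mulrA divfK.
split; first by rewrite rpredM ?act_vring.
move=> xm0; rewrite resM ?act_vring //.
rewrite (@act_res g _ 0) ?rpred0 ?xm0 ?res0 //.
by rewrite rmorph0 res0 mul0r.
Qed.

Lemma expA g : g \in A -> (g ^+ p = 1)%g.
Proof. by move=> gA; have [_ ->] := (abelemP pr_p pA). Qed.

Lemma actX g n y : g \in A -> act (g ^+ n)%g y = iter n (act g) y.
Proof.
move=> gA; elim: n => [|n IHn]; first by rewrite expg0 act1.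
by rewrite expgS actM ?groupX //= IHn.
Qed.

(** For b = g y - y the sum of the g ^ i b telescopes to 0.  If g b / b had
    residue 1, so would every g ^ i b / b, and p would vanish in the residue
    field. *)
Lemma tame_displacement g : g \in A -> (exists y, act g y != y) ->
  exists2 b, b != 0 & res v (act g b / b) != 1.
Proof.
move=> gA [y gy]; pose b := act g y - y; have b0 : b != 0 by rewrite subr_eq0.
exists b => //; apply: contraNneq p_res => rb.
have gb0 : act g b != 0 by rewrite fmorph_eq0.
have [gbO _] := res_div_neq0 ufield gb0 b0 (act_isom g b0).
have bb : b / b = 1 by rewrite divff.
have orb i : act (g ^+ i)%g b / b \in vring_pred v /\
    res v (act (g ^+ i)%g b / b) = 1.
  elim: i => [|i [IH IHr]]; first by rewrite expg0 act1 bb rpred1 res1.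
  rewrite expgS actM ?groupX //=.
  have -> : act g (act (g ^+ i)%g b) / b =
      act g (act (g ^+ i)%g b / b) * (act g b / b).
    by rewrite [act g (_ / b)]fmorph_div mulrA divfK.
  split; first by rewrite rpredM ?act_vring.
  rewrite resM ?act_vring // rb mulr1 -[RHS](res1 v) -(rmorph1 (act g)).
  by apply: act_res; rewrite ?rpred1 // res1.
have sum0 : \sum_(i < p) act (g ^+ i)%g b = 0.
  rewrite (eq_bigr (fun i : 'I_p => act (g ^+ i.+1)%g y - act (g ^+ i)%g y)).
    rewrite sumrB (@big_cyclic_shift _ _ _ p (fun i => act (g ^+ i)%g y)) ?subrr //.
    by rewrite expA // expg0.
  by move=> i _; rewrite rmorphB expgSr actM ?groupX.
have : res v ((\sum_(i < p) act (g ^+ i)%g b) / b) = p%:R.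
  rewrite mulr_suml res_sum => [|i _]; last by case: (orb i).
  rewrite (eq_bigr (fun=> 1)) => [|i _]; last by case: (orb i).
  by rewrite sumr_const card_ord.
by rewrite sum0 mul0r res0 => <-.
Qed.

Let N b m := \sum_(i < p) act (b ^+ i)%g m.
Let stab m := [set g in A | act g m == m].

(** For a and b read as a formal basis of (Z / p) ^ 2: the p lines other than that
    of b cover the origin p times and every element outside the line of b once;
    the latter elements form the cosets a ^ i <b>, with i nonzero. *)
Lemma sum_over_lines a b m : a \in A -> b \in A ->
  m *+ p = \sum_(j < p) N (a * b ^+ j)%g m -
           \sum_(i < p | i != 0%N :> nat) act (a ^+ i)%g (N b m).
Proof.
move=> aA bA; have p0 := prime_gt0 pr_p; have [cA _] := abelemP pr_p pA.
apply/eqP; rewrite eq_sym subr_eq; apply/eqP.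
rewrite exchange_big /= (bigD1 (Ordinal p0)) //=; congr (_ + _).
  under eq_bigr => j _ do rewrite expg0 act1.
  by rewrite sumr_const card_ord.
apply: eq_big => [i|i i0]; first by rewrite -val_eqE.
rewrite -val_eqE /= in i0.
(* For i nonzero, j |-> j * i permutes Z / p, so that summing over the i-th
   points of the lines gives a whole coset of <b>. *)
have cop : coprime p i.
  rewrite prime_coprime // gtnNdvd ?ltn_ord //; by case: (i : nat) i0.
pose phi (j : 'I_p) := Ordinal (ltn_pmod (j * i) p0).
have phi_inj : injective phi.
  move=> j j' /(congr1 val) /= /eqP; wlog le : j j' / (j <= j')%N.
    by move=> H; case/orP: (leq_total j j') => le /[1! eq_sym] => [|/(H _ _ le)//];
       rewrite eq_sym => /(H _ _ le).
  rewrite eq_sym eqn_mod_dvd ?leq_mul2r ?le ?orbT // -mulnBl Gauss_dvdl //.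
  have [e _|ne] := eqVneq (j' - j)%N 0%N.
    by apply/val_inj/eqP; rewrite eqn_leq le -subn_eq0 e.
  by rewrite gtnNdvd ?lt0n // (leq_ltn_trans (leq_subr _ _)).
rewrite /N raddf_sum [RHS](reindex_inj phi_inj) /=; apply: eq_bigr => j _.
rewrite -[RHS]/((act (a ^+ i)%g \o act (b ^+ (j * i %% p)%N)%g) m).
rewrite -actM ?groupX // expg_mod ?expA // expgM -expgMn //.
by apply: (centsP cA); rewrite ?groupX.
Qed.

Lemma orbit_sum_vring b m : m != 0 -> N b m / m \in vring_pred v.
Proof.
move=> m0; rewrite mulr_suml rpred_sum // => i _.
have mm : m / m \in vring_pred v by rewrite divff ?rpred1.
by have [] := act_div (b ^+ i)%g m0 mm.
Qed.

Lemma orbit_sum_fixed b m : b \in A -> act b (N b m) = N b m.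
Proof.
move=> bA; rewrite raddf_sum /=.
rewrite -[RHS](@big_cyclic_shift _ _ _ p (fun i => act (b ^+ i)%g m)).
  by apply: eq_bigr => i _; rewrite expgS actM ?groupX.
by rewrite expA // expg0.
Qed.

Lemma actC a b y : a \in A -> b \in A -> act a (act b y) = act b (act a y).
Proof.
move=> aA bA; have [cA _] := abelemP pr_p pA.
by rewrite -[LHS]/((act a \o act b) y) -actM // (centsP cA) // actM.
Qed.

(** Replacing m by [N b m] enlarges the stabiliser, as it adds b to it, and keeps
    the value as long as N b m / m is a unit. *)
Lemma maximal_stabiliser y : y != 0 -> exists m, [/\ m != 0, v m = v y
  & forall b, b \in A -> act b m != m -> res v (N b m / m) = 0].
Proof.
have [n] := ubnP (#|A| - #|stab y|); elim: n => // n IHn in y *.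
rewrite ltnS => le_n y0; have [|none] := boolP [exists b in A,
    (act b y != y) && (res v (N b y / y) != 0)]; last first.
  exists y; split=> // b bA by_; apply: contraNeq none => rN.
  by apply/exists_inP; exists b; rewrite // by_.
case/exists_inP => b bA /andP[by_ rN].
have [Ny0 vN] := val_div_res ufield y0 (orbit_sum_vring b y0) rN.
suff lt_n : (#|A| - #|stab (N b y)| < n)%N.
  by have [m [m0 vm Hm]] := IHn _ lt_n Ny0; exists m; rewrite vm.
have : stab y \proper stab (N b y).
  apply/properP; split; last first.
    exists b; first by rewrite inE bA orbit_sum_fixed /=.
    by rewrite inE bA.
  apply/subsetP => s; rewrite !inE => /andP[sA /eqP sy].
  rewrite sA raddf_sum; apply/eqP/eq_bigr => i _ /=.
  by rewrite actC ?groupX // sy.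
move/proper_card => lt; have le : (#|stab (N b y)| <= #|A|)%N.
  by apply/subset_leq_card/subsetP => s; rewrite inE => /andP[].
apply: leq_trans le_n; rewrite ltn_sub2l //.
exact: leq_trans lt le.
Qed.

(** Otherwise every term on the right of [sum_over_lines], divided by m, has
    residue 0, while m *+ p / m has residue p.  So the cosets of the stabiliser of
    m are represented by the powers of b. *)
Lemma stabiliser_index a b m : a \in A -> b \in A -> m != 0 ->
    (forall c, c \in A -> act c m != m -> res v (N c m / m) = 0) ->
    act b m != m ->
  exists j : 'I_p, act (a * b ^+ j)%g m = m.
Proof.
move=> aA bA m0 Nm bm; apply/'exists_eqP; apply: contraR p_res.
rewrite negb_exists => /forallP mv.
have : res v (m *+ p / m) = 0.
  rewrite (sum_over_lines _ aA bA) mulrBl !mulr_suml.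
  have NO c : N c m / m \in vring_pred v := orbit_sum_vring c m0.
  have aNO i : act (a ^+ i)%g (N b m) / m \in vring_pred v.
    by have [] := act_div (a ^+ i)%g m0 (NO b).
  rewrite resD ?rpredN ?rpred_sum //.
  rewrite -sumrN !res_sum // => [|i _]; last by rewrite rpredN.
  rewrite !big1 ?addr0 // => [i _|j _]; last by rewrite Nm ?groupM ?groupX.
  have [_ /(_ (Nm b bA bm)) z] := act_div (a ^+ i)%g m0 (NO b).
  apply/eqP; rewrite res_eq0 ?rpredN //.
  have : act (a ^+ i)%g (N b m) / m \in videal_pred v.
    by rewrite -res_eq0 // z.
  by rewrite !unfold_in oppr_eq0 Defs.valN.
by rewrite -[m *+ p]mulr_natr mulrAC divff // mul1r res_nat => ->.
Qed.

(** Take m from [maximal_stabiliser].  If some b in A moves m, the product of the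
    b ^ i m is fixed by b and by the stabiliser of m, which together generate A. *)
Lemma exp_p_invariant_value y : y != 0 -> exists z,
  [/\ z != 0, {in A, forall g, act g z = z} & v z = v (y ^+ p)].
Proof.
move=> y0; have [m [m0 vm Nm]] := maximal_stabiliser y0.
have valX x : x != 0 -> v (x ^+ p) = v x *+ p.
  by move=> x0; rewrite val_exp // => n; rewrite expf_neq0.
have [fixm|] := boolP [forall b in A, act b m == m].
  exists (m ^+ p); split; rewrite ?expf_neq0 // ?valX ?vm // => g gA.
  by rewrite rmorphXn /=; have /forall_inP/(_ g gA)/eqP -> := fixm.
rewrite negb_forall_in => /exists_inP[b bA bm].
pose z := \prod_(i < p) act (b ^+ i)%g m.
have bz : act b z = z.
  rewrite rmorph_prod /=.
  rewrite -[RHS](@big_cyclic_shift _ _ _ p (fun i => act (b ^+ i)%g m)).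
    by apply: eq_bigr => i _; rewrite expgS actM ?groupX.
  by rewrite expA // expg0.
have bXz j : act (b ^+ j)%g z = z.
  by rewrite actX //; elim: j => //= j ->.
exists z; split=> [|g gA|].
- by apply/prodf_neq0 => i _; rewrite fmorph_eq0.
- have [j gbm] := stabiliser_index gA bA m0 Nm bm.
  rewrite -{1}(bXz j) -[LHS]/((act g \o act (b ^+ j)%g) z) -actM ?groupX //.
  rewrite rmorph_prod; apply: eq_bigr => i _ /=.
  by rewrite actC ?groupM ?groupX // gbm.
- rewrite valX // -vm.
  have [//] : v z = v m *+ p /\ z != 0.
  rewrite /z; elim: p => [|n [IHn zn0]].
    by rewrite big_ord0 oner_neq0 (Defs.val1 v).
  have gm0 : act (b ^+ n)%g m != 0 by rewrite fmorph_eq0.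
  rewrite big_ord_recr /= Defs.valM // mulf_neq0 // act_isom // IHn.
  by rewrite -mulrSr.
Qed.

End Isometries.

(** * Galois maximal subfields of a central division algebra *)

Section BilinearIndependence.
Variables (E : fieldType) (D : falgType E).
Hypothesis divD : forall x : D, x != 0 -> x \is a GRing.unit.
Hypothesis centerD : ('Z({:D}) = 1)%VS.

Lemma central_scalar (z : D) : (forall x, z * x = x * z) -> exists c : E, z = c%:A.
Proof.
move=> zC; have : z \in 'Z({:D})%VS.
  by rewrite memv_cap memvf; apply/centvP => x _; rewrite zC.
by rewrite centerD => /vlineP.
Qed.

(** D (x) D embeds in End(D) when the center is E: take a shortest relation,
    normalise its last coefficient to 1 and commute it with e; the result is
    shorter, so all coefficients commute with e, hence are scalars, and d = 1
    contradicts the independence of the b i. *)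
Lemma bilinear_independence (b : nat -> D) (N : nat) :
    (forall n (k : nat -> E), (n <= N)%N -> \sum_(i < n) k i *: b i = 0 ->
       forall i, (i < n)%N -> k i = 0) ->
  forall n (c : nat -> D), (n <= N)%N ->
    (forall d, \sum_(i < n) c i * d * b i = 0) -> forall i, (i < n)%N -> c i = 0.
Proof.
move=> free_b; elim=> // n IHn c lt_nN c_rel.
have [cn0|cn0] := eqVneq (c n) 0.
  move=> i; rewrite ltnS leq_eqVlt => /predU1P[-> //|]; move: i.
  apply: IHn (ltnW lt_nN) _ => d.
  by have := c_rel d; rewrite big_ord_recr /= cn0 !mul0r addr0.
pose c' i := (c n)^-1 * c i.
have c'n : c' n = 1 by rewrite /c' mulVr ?divD.
have c'_rel d : \sum_(i < n.+1) c' i * d * b i = 0.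
  transitivity ((c n)^-1 * \sum_(i < n.+1) c i * d * b i).
    by rewrite mulr_sumr; apply: eq_bigr => i _; rewrite !mulrA.
  by rewrite c_rel mulr0.
have c'C e i : (i < n.+1)%N -> c' i * e = e * c' i.
  rewrite ltnS leq_eqVlt => /predU1P[->|]; first by rewrite c'n mul1r mulr1.
  move=> lt_in; apply/eqP; rewrite -subr_eq0; apply/eqP; move: i lt_in.
  apply: IHn (ltnW lt_nN) _ => d.
  have : \sum_(i < n.+1) c' i * (e * d) * b i - e * \sum_(i < n.+1) c' i * d * b i = 0.
    by rewrite !c'_rel mulr0 subrr.
  rewrite mulr_sumr -sumrB big_ord_recr /= c'n !mul1r mulrA subrr addr0.
  by move=> {2}<-; apply: eq_bigr => i _ /=; rewrite mulrBl !mulrA mulrBl.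
have c'E i : exists k : E, (i < n.+1)%N ==> (c' i == k%:A).
  case: ltnP => [lt_in|_]; last by exists 0.
  have [|k ->] := @central_scalar (c' i); first by move=> x; rewrite c'C.
  by exists k; rewrite eqxx.
pose k i := xchoose (c'E i).
have kE i : (i < n.+1)%N -> c' i = (k i)%:A.
  by move=> lt_in; have /implyP/(_ lt_in)/eqP := xchooseP (c'E i).
have kn0 : k n = 0.
  apply: (free_b n.+1 k lt_nN) (leqnn _).
  rewrite -[RHS](c'_rel 1); apply: eq_bigr => j _.
  by rewrite kE // mulr1 mulr_algl.
by move: c'n; rewrite kE // kn0 scale0r => /esym/eqP; rewrite oner_eq0.
Qed.

End BilinearIndependence.

Section GaloisSubfield.
Variables (E : fieldType) (D : falgType E) (L : splittingFieldType E).
Variable f : 'AHom(L, D).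
Hypothesis divD : forall x : D, x != 0 -> x \is a GRing.unit.
Hypothesis centerD : ('Z({:D}) = 1)%VS.
Hypothesis galL : galois 1 {:L}.
Local Notation "r ^%:A" := (map_poly (in_alg L) r) (at level 2, format "r ^%:A").
Implicit Types (a : L) (q : {poly L}) (d : D).

Lemma ahom_scale (c : E) (y : L) : f (c *: y) = c *: f y.
Proof. exact: linearZZ. Qed.

Lemma gal_scale (g : gal_of {:L}) (c : E) (y : L) : g (c *: y) = c *: g y.
Proof. exact: linearZZ. Qed.

(** D is an L-bimodule, hence a module over L (x) L, which is a quotient of L[X]
    when a generates L: constants act by left multiplication and X by right
    multiplication by f a. *)
Definition bimod_act (a : L) (q : {poly L}) (d : D) :=
  \sum_(i < size q) f q`_i * d * f a ^+ i.

Lemma bimod_act_wide a n q d : (size q <= n)%N ->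
  bimod_act a q d = \sum_(i < n) f q`_i * d * f a ^+ i.
Proof.
move=> le_qn; rewrite /bimod_act (big_ord_widen n (fun i => f q`_i * d * f a ^+ i)) //.
rewrite big_mkcond; apply: eq_bigr => i _; case: ltnP => // /(nth_default 0) ->.
by rewrite rmorph0 !mul0r.
Qed.

Lemma bimod_actD a q (r : {poly L}) d :
  bimod_act a (q + r) d = bimod_act a q d + bimod_act a r d.
Proof.
set n := maxn (size q) (size r).
rewrite !(@bimod_act_wide a n) ?leq_maxl ?leq_maxr ?size_polyD // -big_split.
by apply: eq_bigr => i _; rewrite coefD rmorphD !mulrDl.
Qed.

Lemma bimod_actZ a c q d : bimod_act a (c *: q) d = f c * bimod_act a q d.
Proof.
rewrite (bimod_act_wide _ _ (size_scale_leq c q)) mulr_sumr.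
by apply: eq_bigr => i _; rewrite coefZ rmorphM !mulrA.
Qed.

Lemma bimod_actMX a q d : bimod_act a (q * 'X) d = bimod_act a q d * f a.
Proof.
have [->|q0] := eqVneq q 0.
  by rewrite mul0r /bimod_act size_poly0 !big_ord0 mul0r.
rewrite /bimod_act size_mulX // big_ord_recl coefMX rmorph0 !mul0r add0r mulr_suml.
by apply: eq_bigr => i _; rewrite coefMX /= exprSr !mulrA.
Qed.

Lemma bimod_actC a c d : bimod_act a c%:P d = f c * d.
Proof.
by rewrite (bimod_act_wide _ _ (size_polyC_leq1 c)) big_ord1 coefC mulr1.
Qed.

Lemma bimod_actM a q (r : {poly L}) d :
  bimod_act a (q * r) d = bimod_act a q (bimod_act a r d).
Proof.
elim/poly_ind: q => [|q c IHq].
  by rewrite mul0r /bimod_act size_poly0 !big_ord0.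
rewrite mulrDl mulrAC mul_polyC !bimod_actD !bimod_actMX bimod_actZ bimod_actC.
by rewrite IHq.
Qed.

(** Scalars of E act equally on both sides, so a polynomial over E acts by right
    multiplication by its value at a. *)
Lemma bimod_act_base a (r : {poly E}) d :
  bimod_act a (r ^%:A) d = d * f (r ^%:A).[a].
Proof.
rewrite /bimod_act horner_coef raddf_sum mulr_sumr; apply: eq_bigr => i _ /=.
by rewrite rmorphM rmorphXn coef_map /= ahom_scale rmorph1 !mulr_algl -scalerAl -scalerAr.
Qed.

Lemma bimod_act_XsubC a c d :
  bimod_act a ('X - c%:P) d = d * f a - f c * d.
Proof.
rewrite (@bimod_act_wide a 2) ?size_XsubC // !big_ord_recl big_ord0.
rewrite !coefB !coefX !coefC /=.
by rewrite subr0 sub0r rmorphN rmorph1 mulr1 mul1r addr0 mulNr addrC.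
Qed.

Section Generator.
Variable a : L.
Hypothesis gen_a : <<1%AS; a>>%VS = {:L}%VS.

Lemma generatorP y : exists r : {poly E}, y = (r ^%:A).[a].
Proof.
have : y \in <<1%AS; a>>%VS by rewrite gen_a memvf.
by case/Fadjoin_polyP => q /polyOver1P[r ->] ->; exists r.
Qed.

Lemma twist_generator (g : gal_of {:L}) (u : D) :
  u * f a = f (g a) * u -> forall y, u * f y = f (g y) * u.
Proof.
move=> ua y; have [r ->] := generatorP y.
rewrite !horner_coef !raddf_sum mulr_sumr mulr_suml; apply: eq_bigr => i _ /=.
rewrite coef_map /= !mulr_algl gal_scale !ahom_scale -scalerAl -scalerAr.
congr (_ *: _); elim: (i : nat) => [|n IHn].
  by rewrite expr0 !rmorph1 mulr1 mul1r.
by rewrite !exprS !rmorphM mulrA ua -mulrA IHn mulrA.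
Qed.

(** The minimal polynomial of a, described by what is used of it: over L it is
    the product of the X - g a for the distinct conjugates g a of a. *)
Lemma minimal_relation : exists r : {poly E}, [/\ r != 0, (r ^%:A).[a] = 0,
     forall q : {poly E}, (q ^%:A).[a] = 0 -> (size q < size r)%N -> q = 0
   & forall q : {poly L}, (forall g : gal_of {:L}, q.[g a] = 0) -> r ^%:A %| q].
Proof.
have [s /= [_ uniq_s mp]] := galois_factors (sub1v _) galL a (memvf a).
have /polyOver1P[r rE] := minPolyOver 1%AS a.
exists r; split; rewrite -?rE.
- by rewrite -(map_poly_eq0 (in_alg L)) -rE monic_neq0 ?monic_minPoly.
- exact/eqP/root_minPoly.
- move=> q qa lt_qr; apply/eqP; apply: contraLR lt_qr => q0; rewrite -leqNgt.
  rewrite -(size_map_poly (in_alg L) q) -(size_map_poly (in_alg L) r) -rE.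
  apply: dvdp_leq; first by rewrite map_poly_eq0.
  by apply: minPoly_dvdp; [apply/polyOver1P; exists q | apply/eqP].
- move=> q qa; rewrite mp; apply: uniq_roots_dvdp; last by rewrite uniq_rootsE.
  by apply/allP => _ /mapP[g _ ->]; apply/eqP.
Qed.

Lemma base_gal (r : {poly E}) (g : gal_of {:L}) : (r ^%:A).[g a] = g (r ^%:A).[a].
Proof.
rewrite -horner_map -map_poly_comp; congr _.[_].
by apply: eq_map_poly => c /=; rewrite gal_scale rmorph1.
Qed.

(** Divide the minimal polynomial of a by X - g a.  The quotient has too small a
    degree to act as zero on D, by [bilinear_independence]; a nonzero value u of
    its action is killed by X - g a, so that u * f a = f (g a) * u. *)
Lemma skolem_noether (g : gal_of {:L}) :
  exists2 u : D, u != 0 & forall y, u * f y = f (g y) * u.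
Proof.
have [r [r0 ra minr _]] := minimal_relation.
have : root (r ^%:A) (g a) by rewrite /root base_gal ra rmorph0.
case/factor_theorem => q qE.
have q0 : q != 0.
  by apply: contraNneq r0 => q0; rewrite -(map_poly_eq0 (in_alg L)) qE q0 mul0r.
have sz_r : size r = (size q).+1.
  by rewrite -(size_map_poly (in_alg L)) qE size_Mmonic ?monicXsubC // size_XsubC addn2.
have [d qd0] : exists d, bimod_act a q d != 0.
  apply: NNPP => no_d; case/negP: (q0); rewrite -lead_coef_eq0 lead_coefE.
  rewrite -(fmorph_eq0 f); apply/eqP.
  apply: (@bilinear_independence E D divD centerD (fun i => f a ^+ i) (size q) _
    (size q) (fun i => f q`_i)) => // [n k le_nq krel i lt_in|d|].
  - have kE : (\poly_(j < n) k j) = 0.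
      apply: minr; last by rewrite sz_r ltnS (leq_trans (size_poly _ _)).
      apply/eqP; rewrite -(fmorph_eq0 f) -krel; apply/eqP.
      have le_n : (size ((\poly_(j < n) k j) ^%:A) <= n)%N.
        by rewrite size_map_poly size_poly.
      rewrite (horner_coef_wide _ le_n) raddf_sum; apply: eq_bigr => j _ /=.
      by rewrite coef_map coef_poly ltn_ord /= mulr_algl ahom_scale rmorphXn.
    by have := coef_poly n k i; rewrite kE lt_in coef0 => <-.
  - by apply/eqP/negPn/negP => qd; apply: no_d; exists d.
  - by rewrite prednK // size_poly_gt0.
exists (bimod_act a q d) => //; apply: twist_generator; apply/eqP.
rewrite -subr_eq0; apply/eqP; have := bimod_act_base a r d.
rewrite ra rmorph0 mulr0 qE mulrC bimod_actM => <-.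
by rewrite bimod_act_XsubC.
Qed.

(** Multiplied by X - a, such a q becomes a multiple of the minimal polynomial of
    a, which acts as zero. *)
Lemma interpolation_commutes (q : {poly L}) d :
    (forall g : gal_of {:L}, g a != a -> q.[g a] = 0) ->
  forall y, bimod_act a q d * f y = f y * bimod_act a q d.
Proof.
move=> q0 y; have [r [_ ra _ divr]] := minimal_relation.
have /divr/dvdpP[q' qE] : forall g : gal_of {:L}, (('X - a%:P) * q).[g a] = 0.
  move=> g; rewrite hornerM hornerXsubC; have [->|/q0 ->] := eqVneq (g a) a.
    by rewrite subrr mul0r.
  by rewrite mulr0.
have commd : bimod_act a q d * f a = f a * bimod_act a q d.
  apply/eqP; rewrite -subr_eq0 -bimod_act_XsubC -bimod_actM qE bimod_actM.
  rewrite bimod_act_base ra rmorph0 mulr0 /bimod_act big1 // => i _.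
  by rewrite mulr0 mul0r.
have := @twist_generator 1%g (bimod_act a q d); rewrite gal_id => /(_ commd y).
by rewrite gal_id.
Qed.

End Generator.

Lemma galois_generator : exists a, <<1%AS; a>>%VS = {:L}%VS.
Proof.
have /and3P[_ sepL _] := galL.
by exists (separable_generator 1%AS {:L}%AS);
  rewrite -(eq_adjoin_separable_generator sepL (sub1v _)).
Qed.

(** The double centraliser of M + E z is commutative, as M + E z is, and closed
    under inverses; by maximality it equals M. *)
Lemma maximal_subfield_centralizer : maximal_subfield (limg f) ->
  forall z, (forall y, z * f y = f y * z) -> exists y, z = f y.
Proof.
case=> -[_ _ _ _ ] maxM z zC; pose U := (limg f + <[z]>)%VS.
have fC x y : f x * f y = f y * f x by rewrite -!rmorphM mulrC.
have UU : (U <= 'C(U))%VS.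
  apply/centvsP => x y /memv_addP[_ /memv_imgP[x' _ ->] [_ /vlineP[c ->] ->]].
  case/memv_addP => _ /memv_imgP[y' _ ->] [_ /vlineP[e ->] ->].
  rewrite !mulrDl !mulrDr -!scalerAl -!scalerAr !zC fC.
  by rewrite addrACA !scalerA [c * e]mulrC.
pose K := 'C('C(U))%AS.
have UK : (U <= 'C('C(U)))%VS by rewrite centvC subvv.
have KU : ('C('C(U)) <= 'C(U))%VS.
  by apply/subvP => x /centvP xC; apply/centvP => y /(subvP UU)/xC.
have KC : {in K &, commutative *%R}.
  by move=> x y /centvP xC /(subvP KU)/xC.
have subK : is_subfield K.
  split=> //; [exact: centv1 | exact: memvM |] => x /centvP xC; apply/centvP => y yU.
  have [->|/divD ux] := eqVneq x 0; first by rewrite invr0 mul0r mulr0.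
  by rewrite -[y in LHS](mulrK ux) -(xC y yU) !mulrA mulVr // mul1r.
have MU : (limg f <= U)%VS by exact: addvSl.
have eqKM := maxM K subK (subv_trans MU UK).
have : z \in limg f by rewrite -eqKM (subvP UK) // memvE addvSr.
by case/memv_imgP => y _ ->; exists y.
Qed.

End GaloisSubfield.

(** * Automorphisms of the residue field and the exponent of the Galois group *)

Lemma finite_comprehension (T : finType) (P : T -> Prop) :
  exists A : {set T}, forall x, x \in A <-> P x.
Proof.
suff [A AP] : exists A : {set T}, forall x, x \in enum T -> (x \in A <-> P x).
  by exists A => x; apply: AP; rewrite mem_enum.
elim: (enum T) => [|y s [A AP]]; first by exists set0.
have [Py|nPy] := classic (P y); [exists (y |: A) | exists (A :\ y)] => x.
  rewrite !inE; have [-> _|_ /= xs] := eqVneq x y; first by split.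
  by apply: AP.
rewrite !inE; have [-> _|_ /= xs] := eqVneq x y; first by split.
by apply: AP.
Qed.

(** With t = g b / b - 1, the operator that kills the component D_g changes d only
    by a multiple of d - b^-1 * d * b, which has residue 0 when conjugation by b
    fixes the residue of d. *)
Lemma elimination_identity (R : unitRingType) (t b d : R) :
    t \is a GRing.unit -> b \is a GRing.unit ->
  t^-1 / b * (b * (t + 1) * d - d * b) = d + t^-1 * (d - b^-1 * d * b).
Proof.
move=> ut ub; rewrite -!mulrA mulrBr mulKr // mulrDl mul1r -addrA mulrDr.
by rewrite mulKr.
Qed.

Section Normaliser.
Variables (G : orderedGroupType) (E : fieldType) (v : valuation G E).
Variables (D : falgType E) (w : extension v D) (p : nat).
Variables (L : splittingFieldType E) (f : 'AHom(L, D)).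
Hypothesis divD : forall x : D, x != 0 -> x \is a GRing.unit.
Hypothesis centerD : ('Z({:D}) = 1)%VS.
Hypothesis maxM : maximal_subfield (limg f).
Hypothesis galL : galois 1 {:L}.
Hypotheses (pr_p : prime p) (abelL : (p.-abelem 'Gal({:L} / 1))%g).
Hypothesis p_char : p \notin [pchar residue_field v].
Notation K := (residue_algebra w).
Notation k := (residue_field v).

(** x acts on M by conjugation as g does on L. *)
Definition twists (g : gal_of {:L}) (x : D) : Prop :=
  x != 0 /\ forall y, x * f y = f (g y) * x.

Let act (g : gal_of {:L}) : {rmorphism L -> L} := gal_repr g.
Let ufL (x : L) : x != 0 -> x \is a GRing.unit.
Proof. by rewrite unitfE. Qed.

Let vL : valuation G L := pullback f w.

Lemma mem_gal (g : gal_of {:L}) : g \in 'Gal({:L} / 1)%g.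
Proof.
rewrite gal_kHom ?sub1v //; apply/kAHomP => _ /vlineP[c ->].
by rewrite [LHS]gal_scale rmorph1.
Qed.

Lemma act1 : act 1%g =1 id.
Proof. by move=> y; rewrite /act /= gal_id. Qed.

Lemma actM (g h : gal_of {:L}) : act (g * h)%g =1 act g \o act h.
Proof.
move=> y; have [cL _] := abelemP pr_p abelL.
by rewrite /act /= (centsP cL _ (mem_gal g) _ (mem_gal h)) galM ?memvf.
Qed.

(** g is induced by a conjugation of D, and conjugations preserve w since the
    value group is commutative. *)
Lemma gal_isometry (g : gal_of {:L}) y : y != 0 -> vL (act g y) = vL y.
Proof.
move=> y0; have [a gen_a] := galois_generator galL.
have [u u0 uf] := skolem_noether f divD centerD galL gen_a g.
have -> : vL (act g y) = w (u * f y * u^-1).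
  by rewrite uf mulrK ?divD.
by rewrite val_conj ?fmorph_eq0.
Qed.

Lemma p_residue : p%:R != 0 :> k.
Proof. by apply: contra p_char => p0; rewrite inE pr_p. Qed.

Lemma p_residue_vL : p%:R != 0 :> residue vL.
Proof.
have := p_residue; rewrite -(res_nat v) -(res_nat vL).
rewrite !res_eq0 ?rpred_nat // pullback_videal rmorph_nat.
rewrite !unfold_in !negb_or => /andP[p0 vp].
have pE : p%:R = (p%:R : E)%:A :> D by rewrite scaler_nat.
have pD0 : p%:R != 0 :> D by rewrite pE scaler_eq0 oner_eq0 orbF.
by rewrite pD0 pE extP.
Qed.

(** y ^+ p has the value of an element fixed by Gal(L / E), that is, of one of E. *)
Lemma exp_p_value y : y != 0 -> exists2 c : E, c != 0 & w (f (y ^+ p)) = w c%:A.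
Proof.
move=> y0.
have [z [z0 fz vz]] := exp_p_invariant_value pr_p abelL act1
  (in2W actM) gal_isometry p_residue_vL y0.
have : z \in (1%AS : {vspace L}).
  have /galois_fixedField <- := galL.
  by apply/fixedFieldP => [|g gG]; [exact: memvf | exact: fz].
case/vlineP => c zE; exists c.
  by apply: contraNneq z0 => c0; rewrite zE c0 scale0r.
by rewrite -[LHS]vz zE /vL /= ahom_scale rmorph1.
Qed.

Let fixed_by_L (d : D) : Prop := d \in vring_pred w /\
  forall y : L, y != 0 -> res w (f y * d * (f y)^-1) = res w d.

(** The polynomial q acts on D as d |-> (f (g b) * d - d * f b) / f (g b - b), for
    some b with b and g b - b of equal value. *)
Lemma elimination_step (a : L) (g : gal_of {:L}) :
    <<1%AS; a>>%VS = {:L}%VS -> g a != a ->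
  exists2 q : {poly L}, q.[g a] = 0 &
    forall d, fixed_by_L d -> fixed_by_L (bimod_act f a q d) /\
      res w (bimod_act f a q d) = res w d.
Proof.
move=> gen_a ga.
have [b b0 rb] : exists2 b : L, b != 0 & res vL (act g b / b) != 1.
  apply: (tame_displacement pr_p abelL act1 (in2W actM) gal_isometry p_residue_vL).
    exact: mem_gal.
  by exists a.
have fb0 : f b != 0 by rewrite fmorph_eq0.
have gb0 : act g b != 0 by rewrite fmorph_eq0.
have [tO _] := res_div_neq0 ufL gb0 b0 (gal_isometry g b0).
pose t := act g b / b - 1.
have tO' : t \in vring_pred vL by rewrite rpredB ?rpred1.
have rt : res w (f t) != 0.
  rewrite -(@pullback_res_eq0 _ _ _ f) //; apply: contraNneq rb => rt.
  rewrite -[_ / _](subrK 1) -/t resD ?rpred1 // rt add0r.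
  exact/eqP/res1.
have ftO : f t \in vring_pred w by rewrite -pullback_vring.
have [ft0 _] := vring_res_neq0 ftO rt.
have [ftVO _] := res_inv divD ftO rt.
have [r bE] := generatorP gen_a b.
pose q : {poly L} := (t * b)^-1 *: ((g b)%:P - map_poly (in_alg L) r).
exists q.
  by rewrite hornerZ hornerD hornerN hornerC base_gal -bE subrr mulr0.
move=> d [dO dfix].
pose e := f b^-1 * d * (f b^-1)^-1.
have bV0 : b^-1 != 0 by rewrite invr_eq0.
have fbV0 : f b^-1 != 0 by rewrite fmorph_eq0.
have eO : e \in vring_pred w by rewrite vring_conj.
have qd : bimod_act f a q d = d + (f t)^-1 * (d - e).
  rewrite bimod_actZ bimod_actD -scaleN1r bimod_actZ rmorphN rmorph1 mulN1r.
  rewrite bimod_actC bimod_act_base -bE invfM rmorphM !fmorphV.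
  have -> : f (g b) = f b * (f t + 1).
    by rewrite -(rmorph1 f) -rmorphD -rmorphM /= subrK mulrC divfK.
  by rewrite /e !fmorphV invrK; apply: elimination_identity; apply: divD.
have deO : (f t)^-1 * (d - e) \in vring_pred w by rewrite rpredM ?rpredB.
have qdO : bimod_act f a q d \in vring_pred w by rewrite qd rpredD.
have qdr : res w (bimod_act f a q d) = res w d.
  apply/eqP; rewrite qd res_eq ?rpredD // addrAC subrr add0r -res_eq0 //.
  have de0 : res w (d - e) = 0.
    by apply/eqP; rewrite res_eq0 ?rpredB // -res_eq // dfix.
  by rewrite resM ?rpredB // de0 mulr0.
split=> //; split=> // y y0; rewrite qdr -(dfix y y0).
by apply: res_conj => //; rewrite fmorph_eq0.
Qed.

(** Composing the elimination steps for all nontrivial g moves d into the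
    centraliser of M without changing its residue. *)
Lemma fixed_residue_in_subfield d : fixed_by_L d ->
  exists y, f y \in vring_pred w /\ res w (f y) = res w d.
Proof.
move=> dfix; have [a gen_a] := galois_generator galL.
have [q q0 [[qO _] qr]] : exists2 q : {poly L},
    forall g, g \in enum [pred g : gal_of {:L} | g a != a] -> q.[g a] = 0 &
    fixed_by_L (bimod_act f a q d) /\ res w (bimod_act f a q d) = res w d.
  have : all (fun g : gal_of {:L} => g a != a) (enum [pred g : gal_of {:L} | g a != a]).
    by apply/allP => g; rewrite mem_enum.
  elim: (enum _) => [_|g s IHs /= /andP[ga /IHs[q q0 [qfix qr]]]].
    by exists 1 => //; rewrite -polyC1 bimod_actC rmorph1 mul1r.
  have [q1 q1g /(_ _ qfix)[q1fix q1r]] := elimination_step gen_a ga.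
  exists (q1 * q); last by rewrite bimod_actM -qr.
  move=> h; rewrite inE => /predU1P[->|/q0 qh]; rewrite hornerM.
    by rewrite q1g mul0r.
  by rewrite qh mulr0.
have [] := @maximal_subfield_centralizer _ _ _ f divD maxM (bimod_act f a q d).
  apply: interpolation_commutes => // g ga; apply: q0.
  by rewrite mem_enum.
by move=> y yE; exists y; rewrite -yE.
Qed.

(** The trace of y has residue |Gal(L / E)| times that of d, and this power of p
    is invertible in k. *)
Lemma fixed_residue_in_base (d : D) : d \in vring_pred w ->
    (forall g x, twists g x -> res w (x * d * x^-1) = res w d) ->
  exists c : k, (res w d : K) = c%:A.
Proof.
move=> dO dfix.
have [|y [yO yr]] := @fixed_residue_in_subfield d.
  split=> // y y0; apply: (dfix 1%g); split; first by rewrite fmorph_eq0.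
  by move=> z; rewrite gal_id -!rmorphM mulrC.
pose t := \sum_(g in 'Gal({:L} / 1)%g) g y.
have : t \in (1%AS : {vspace L}).
  have /galois_fixedField <- := galL.
  apply/fixedFieldP => [|h hG]; first exact: memvf.
  rewrite raddf_sum /t [RHS](reindex_inj (mulIg h)) /=.
  by apply: eq_big => [g|g _]; rewrite ?groupMr // galM ?memvf.
case/vlineP => c tc.
have gy (g : gal_of {:L}) : f (g y) \in vring_pred w /\ res w (f (g y)) = res w d.
  have [a gen_a] := galois_generator galL.
  have [u u0 uf] := skolem_noether f divD centerD galL gen_a g.
  have -> : f (g y) = u * f y * u^-1 by rewrite uf mulrK ?divD.
  rewrite vring_conj //; split=> //.
  by rewrite (res_conj divD u0 yO dO yr) (dfix g u).
have tr : res w (f t) = #|'Gal({:L} / 1)%g|%:R * res w d.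
  rewrite raddf_sum res_sum => [|g _]; last by case: (gy g).
  rewrite (eq_bigr (fun=> res w d)) => [|g _]; last by case: (gy g).
  by rewrite sumr_const mulr_natl.
have tO : c%:A \in vring_pred w.
  have -> : c%:A = f t by rewrite tc ahom_scale rmorph1.
  by rewrite raddf_sum rpred_sum // => g _; case: (gy g).
have cO : c \in vring_pred v.
  move: tO; rewrite !unfold_in scaler_eq0 oner_eq0 orbF.
  by have [//|c0] := eqVneq c 0; rewrite extP.
have n0 : #|'Gal({:L} / 1)%g|%:R != 0 :> k.
  have [n ->] := p_natP (abelem_pgroup abelL).
  by rewrite natrX expf_neq0 // p_residue.
exists (#|'Gal({:L} / 1)%g|%:R^-1 * (res v c : k)).
apply: (scalerI n0); rewrite scalerA mulrA divff // mul1r.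
rewrite scaler_nat -mulr_natl -tr tc ahom_scale rmorph1.
by rewrite -residue_algE // /GRing.scale /= /residue_scale mulr1.
Qed.

Lemma twistsM g h x y : twists g x -> twists h y -> twists (h * g)%g (x * y).
Proof.
move=> [x0 xf] [y0 yf]; split; first exact: div_mulf_neq0.
by move=> z; rewrite -mulrA yf mulrA xf -mulrA galM ?memvf.
Qed.

Lemma twistsX g x n : twists g x -> twists (g ^+ n)%g (x ^+ n).
Proof.
move=> gx; elim: n => [|n IHn].
  by split=> [|y]; rewrite ?oner_neq0 // gal_id mul1r mulr1.
by rewrite exprS expgSr; apply: twistsM.
Qed.

(** x ^+ p induces g ^+ p = 1 on M, so it centralises M. *)
Lemma twists_exp_p g x : twists g x -> exists2 y, y != 0 & x ^+ p = f y.
Proof.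
move=> /(@twistsX _ _ p) []; rewrite (expA pr_p abelL) ?mem_gal // => xp0 xpC.
have [|y yE] := maximal_subfield_centralizer divD maxM (z := x ^+ p).
  by move=> y; rewrite xpC gal_id.
exists y => //; rewrite -(fmorph_eq0 f); apply: contraNneq xp0 => fy0.
by rewrite yE; apply/eqP.
Qed.

Section ResidueField.
Hypothesis fieldK : is_field K.

(** f y ^+ p is a scalar times a unit, and K is commutative. *)
Lemma theta_exp_p y : y != 0 -> theta (f y ^+ p) =1 (id : K -> K).
Proof.
move=> y0 z; have [c c0 wc] := exp_p_value y0.
have cA0 : c%:A != 0 :> D by rewrite scaler_eq0 oner_eq0 orbF.
have yp0 : f (y ^+ p) != 0 by rewrite fmorph_eq0 expf_neq0.
have [eO re] := res_div_neq0 divD yp0 cA0 wc.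
set e := _ / _ in eO re.
have -> : f y ^+ p = e * c%:A by rewrite -rmorphXn /= divrK ?divD.
move: (e) eO re => {}e eO re.
have e0 : e != 0 by have [] := vring_res_neq0 eO re.
rewrite thetaM //; have -> : theta c%:A z = z.
  rewrite /theta mulr_algl -[_ *: _]mulr_algr mulrK ?divD //.
  exact: Defs.liftK.
rewrite -[z in LHS](@Defs.liftK _ _ w) theta_res ?lift_vring //.
have [eVO eV] := res_inv divD eO re.
have [mulC _] := fieldK.
have zO := lift_vring z.
have -> : res w (e * Defs.lift z * e^-1) = res w e * res w (Defs.lift z) * res w e^-1.
  by rewrite resM ?rpredM // [X in X * _]resM.
have mulC' (a b : residue w) : a * b = b * a := mulC a b.
by rewrite [res w e * _]mulC' -mulrA eV mulr1 Defs.liftK.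
Qed.

Variables (d : nat) (Gal : finGroupType) (rho : Gal -> {lrmorphism K -> K}).
Hypothesis dimK : has_dim K d.
Hypothesis sepK : forall z : K, separable_over z.
Hypothesis rhoP : is_galois_group rho.

(** The automorphisms induced by twists are closed under products, and
    [fixed_residue_in_base] computes their fixed field. *)
Lemma automorphism_conjugation h :
  exists g x, twists g x /\ rho h =1 (theta x : K -> K).
Proof.
have [S SP] := finite_comprehension
  (fun h => exists g x, twists g x /\ rho h =1 (theta x : K -> K)).
have [_ rhoM rho_inj rho_surj] := rhoP.
have inS g x : twists g x -> exists2 s, s \in S & rho s =1 (theta x : K -> K).
  move=> gx; have [s sE bij_s] := theta_automorphism w divD (proj1 gx).
  have [t tE] := rho_surj s bij_s.
  have tx : rho t =1 (theta x : K -> K) by move=> z; rewrite tE sE.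
  by exists t => //; apply/SP; exists g, x.
apply/SP; apply: (artin fieldK dimK sepK rhoP _ _ _ h).
- have [|s sS sE] := inS 1%g 1.
    by split=> [|y]; rewrite ?oner_neq0 // gal_id mul1r mulr1.
  suff <- : s = 1%g by [].
  apply: (mulgI s); apply: rho_inj => z.
  by rewrite rhoM /= !sE !theta1 mulg1 sE theta1.
- move=> s t /SP[g [x [gx sx]]] /SP[h' [y [hy ty]]].
  apply/SP; exists (h' * g)%g, (x * y); split; first exact: twistsM.
  by move=> z; rewrite rhoM /= sx ty thetaM // ?(proj1 gx) ?(proj1 hy).
- move=> z zfix; rewrite -[z](@Defs.liftK _ _ w).
  apply: fixed_residue_in_base; first exact: lift_vring.
  move=> g x gx; have [s sS sx] := inS g x gx.
  have x0 := proj1 gx; rewrite -(theta_res divD x0) ?lift_vring //.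
  by rewrite Defs.liftK -sx zfix.
Qed.

Lemma automorphism_exponent (h : Gal) : (h ^+ (p ^ 2)%N = 1)%g.
Proof.
have [_ rhoM rho_inj _] := rhoP.
have rho1 : rho 1%g =1 id.
  have [g [x [[x0 gx] xE]]] := automorphism_conjugation 1%g.
  have [s sE bij_s] := theta_automorphism w divD x0.
  move=> z; apply: (bij_inj bij_s); rewrite !sE -!xE.
  by have := rhoM 1%g 1%g z; rewrite mulg1 => /= <-.
have [g [x [gx hx]]] := automorphism_conjugation h.
have hX n : rho (h ^+ n)%g =1 (theta (x ^+ n) : K -> K).
  elim: n => [|n IHn] z; first by rewrite expg0 rho1 theta1.
  have [xn0 _] := twistsX n gx; have [x0 _] := gx.
  by rewrite expgS rhoM exprS thetaM //= IHn hx.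
have [y y0 yE] := twists_exp_p gx.
apply: rho_inj => z; rewrite hX rho1.
by rewrite (_ : x ^+ (p ^ 2)%N = f y ^+ p) ?theta_exp_p // -yE -exprM.
Qed.

End ResidueField.
End Normaliser.

Theorem proposition3p2 (G : orderedGroupType) (E : fieldType)
    (v : valuation G E) (D : falgType E) (w : extension v D) (p n : nat)
    (Gal : finGroupType)
    (rho : Gal -> {lrmorphism residue_algebra w -> residue_algebra w}) :
  henselian v ->
  central_division_algebra D ->
  prime p -> (1 <= n)%N -> has_degree D (p ^ n) ->
  tame w -> semiramified w ->
  p \notin [pchar residue_field v] ->
  is_galois_group rho ->
  (p ^ 3 %| exponent [set: Gal])%N ->
  ~ exists M : {vspace D}, elementary_abelian_maximal_subfield p M.
Proof.
move=> _ [divD centerD] pr_p _ _ [_ sepK _] [fieldK [d [_ dimK _]]] p_char rhoP.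
move=> exp_p3 [M [maxM [L [f [fM galL abelL]]]]].
have sepK' z : separable_over (z : residue_algebra w).
  by apply: sepK => x; have [mulC _] := fieldK; exact: mulC.
have maxM' : maximal_subfield (limg f) by rewrite fM.
have : (exponent [set: Gal] %| p ^ 2)%N.
  apply/exponentP => h _.
  exact: (automorphism_exponent divD centerD maxM' galL pr_p abelL p_char
    fieldK dimK sepK' rhoP).
by move/(dvdn_trans exp_p3); rewrite dvdn_Pexp2l ?prime_gt1.
Qed.
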